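(* Let $X$ be a complex Hilbert space and $(X_n)_{n\in\mathbb{N}}$ a sequence of closed subspaces of $X$ with orthogonal projections $P_n\colon X\to X_n$ such that $\lim_{n\to\infty}\|u-P_nu\|_X=0$ for each $u\in X$. Let $T\in L(X)$ be bijective, let $A\in L(X)$ be weakly $T$-coercive, and let $$(A_n:=P_nA|_{X_n}\in L(X_n))_{n\in\mathbb{N}}$$ be a $T$-compatible Galerkin approximation of $A$. Then the sequence $(A_n)_{n\in\mathbb{N}}$ is regular.
   Context: $L(X)$ and $L(X_n)$ denote the spaces of bounded linear operators from $X$ to $X$ and from $X_n$ to $X_n$ with the operator norms; $X_n$ carries the norm of $X$. For $A\in L(X)$, $A^*$ is the Hilbert space adjoint. An operator $B\in L(X)$ is coercive if $\inf_{u\in X\setminus\{0\}}|\langle Bu,u\rangle_X|/\|u\|_X^2>0$. It is weakly coercive if there is a compact $K\in L(X)$ such that $B+K$ is coercive. For bijective $T\in L(X)$, $A\in L(X)$ is weakly $T$-coercive if $T^*A$ is weakly coercive. Discrete norm: for an operator $S$ that is a sum of operators in $L(X)$ and $L(X_n)$, $\|S\|_n:=\sup_{u_n\in X_n\setminus\{0\}}\|Su_n\|_X/\|u_n\|_X$. For weakly $T$-coercive $A$, the sequence of Galerkin approximations $(A_n=P_nA|_{X_n})_{n}$ is called $T$-compatible if every $A_n\in L(X_n)$ is Fredholm with index zero and there exists a sequence of index zero Fredholm operators $(T_n\in L(X_n))_{n\in\mathbb{N}}$ such that $\lim_{n\to\infty}\|T-T_n\|_n=0$. A sequence $(u_n\in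 X)_{n}$ is compact if every subsequence has a converging subsubsequence. A sequence $(A_n\in L(X_n))_{n}$ is regular if for every bounded sequence $(u_n\in X_n)_{n\in\mathbb{N}}$ the compactness of $(A_nu_n)_{n}$ implies the compactness of $(u_n)_{n}$. *)

(* Defs.v *)
From HB Require Import structures.
From mathcomp Require Import all_boot all_order all_algebra.
From mathcomp Require Import sesquilinear complex.
From mathcomp Require Import all_classical all_reals all_analysis.

Set Implicit Arguments.
Unset Strict Implicit.
Unset Printing Implicit Defensive.

Import Order.TTheory GRing.Theory Num.Theory.
Import numFieldNormedType.Exports.

Local Open Scope classical_set_scope.
Local Open Scope ring_scope.
Local Open Scope complex_scope.

(* The inner product is linear in its first and antilinear in its second
   argument. *)
HB.mixin Record CompleteNormedModule_isHilbert (R : realType) X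
    & CompleteNormedModule R[i] X := {
  inner : {dot X for (@Num.conj R[i])} ;
  innerE : forall u : X, inner u u = `|u| ^+ 2
}.

#[short(type="hilbertType")]
HB.structure Definition Hilbert (R : realType) :=
  {X of CompleteNormedModule R[i] X & CompleteNormedModule_isHilbert R X}.

(* Norms of complex normed modules take their values in R[i], where they are
   nonnegative reals; [rnorm] is the same number in R. *)
Definition rnorm (R : realType) (V : normedZmodType R[i]) (u : V) : R :=
  complex.Re `|u|.

Section BoundedOperators.
Variable K : numFieldType.

Record bounded_op (E F : normedModType K) := BoundedOp {
  bop_fun :> {linear E -> F} ;
  bop_bounded : exists M : K, forall u, `|bop_fun u| <= M * `|u|
}.

Program Definition bop_comp (E F G : normedModType K)
    (B : bounded_op F G) (A : bounded_op E F) : bounded_op E G :=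
  @BoundedOp E G (B \o A) _.
Next Obligation.
move=> E F G B A; have [MB hB] := bop_bounded B; have [MA hA] := bop_bounded A.
exists (`|MB| * `|MA|) => u /=; rewrite -mulrA.
apply: (le_trans (hB _)); apply: (@le_trans _ _ (`|MB| * `|A u|)).
  by rewrite -[leLHS]ger0_norm ?normrM ?normr_id // (le_trans _ (hB _)).
rewrite ler_wpM2l //; apply: (le_trans (hA _)).
by rewrite -[leLHS]ger0_norm ?normrM ?normr_id // (le_trans _ (hA _)).
Qed.

Program Definition bop_add (E F : normedModType K) (A B : bounded_op E F) :
    bounded_op E F := @BoundedOp E F (A \+ B) _.
Next Obligation.
move=> E F A B; have [MA hA] := bop_bounded A; have [MB hB] := bop_bounded B.
exists (MA + MB) => u /=; rewrite mulrDl.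
exact: (le_trans (ler_normD _ _) (lerD (hA u) (hB u))).
Qed.

End BoundedOperators.

Notation "''L' ( E )" := (bounded_op E E) (format "''L' ( E )") : type_scope.

Section ClosedSubspaces.
Variables (K : numFieldType) (X : normedModType K).

Record closed_subspace := ClosedSubspace {
  cs_pred : {pred X} ;
  cs_submod : submod_closed cs_pred ;
  cs_closed : closed [set u | u \in cs_pred]
}.

Definition cs_type (V : closed_subspace) := {u : X | u \in cs_pred V}.

Variable V : closed_subspace.

HB.instance Definition _ :=
  GRing.isSubmodClosed.Build K X (cs_pred V) (cs_submod V).
HB.instance Definition _ := SubChoice.on (cs_type V).
HB.instance Definition _ := [SubChoice_isSubLmodule of cs_type V by <:].

Let cs_norm (u : cs_type V) : K := `|val u|.

Let cs_normD u v : cs_norm (u + v) <= cs_norm u + cs_norm v.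
Proof. by rewrite /cs_norm raddfD ler_normD. Qed.

Let cs_normZ (l : K) u : cs_norm (l *: u) = `|l| * cs_norm u.
Proof. by rewrite /cs_norm linearZ normrZ. Qed.

Let cs_norm0_eq0 u : cs_norm u = 0 -> u = 0.
Proof. by move=> /normr0_eq0 u0; apply: val_inj; rewrite u0 raddf0. Qed.

HB.instance Definition _ :=
  Lmodule_isNormed.Build K (cs_type V) cs_normD cs_normZ cs_norm0_eq0.

Program Definition cs_incl : bounded_op (cs_type V) X :=
  @BoundedOp K (cs_type V) X (val : cs_type V -> X) _.
Next Obligation. by exists 1 => u; rewrite mul1r. Qed.

End ClosedSubspaces.

Coercion cs_type : closed_subspace >-> Sortclass.

Section FiniteDimension.
Variables (K : numFieldType) (E : normedModType K).

(* [e] is a basis of the quotient S / R; R is meant to be a subspace of S. *)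
Definition basis_mod (S R : set E) (d : nat) (e : 'I_d -> E) :=
  (forall i, S (e i)) /\
  (forall u, S u -> exists! c : 'rV[K]_d, R (u - \sum_i c 0 i *: e i)).

Definition dim_eq (S : set E) (d : nat) :=
  exists e : 'I_d -> E, basis_mod S [set 0] e.

Definition codim_eq (R : set E) (d : nat) :=
  exists e : 'I_d -> E, basis_mod setT R e.

End FiniteDimension.

(* The range of a bounded operator between Banach spaces is closed as soon as
   it has finite codimension. *)
Definition fredholm_of_index (K : numFieldType) (E F : normedModType K)
    (B : bounded_op E F) (i : int) :=
  exists k c : nat,
    [/\ dim_eq [set u | B u = 0] k, codim_eq (range B) c & i = k%:Z - c%:Z].

Section Operators.
Variables (R : realType) (X : hilbertType R).

Definition coercive (B : 'L(X)) : Prop :=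
  (0 < ereal_inf [set ((rnorm (inner (B u) u : R[i]) / rnorm u ^+ 2)%R)%:E
                 | u in [set u : X | (u != 0)%R]])%E.

Definition compact_op (B : 'L(X)) : Prop :=
  forall S : set X, bounded_set S -> precompact (B @` S).

Definition weakly_coercive (B : 'L(X)) : Prop :=
  exists C : 'L(X), compact_op C /\ coercive (bop_add B C).

(* By the Riesz representation theorem each A has exactly one adjoint. *)
Definition is_adjoint (A A' : 'L(X)) : Prop :=
  forall u v : X, inner (A u) v = inner u (A' v).

Definition weakly_T_coercive (T A : 'L(X)) : Prop :=
  exists T' : 'L(X), is_adjoint T T' /\ weakly_coercive (bop_comp T' A).

Definition orthogonal_projection (V : closed_subspace X)
    (P : bounded_op X V) : Prop :=
  forall (u : X) (v : V), inner (u - \val (P u)) (\val v) = 0.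

Definition galerkin (A : 'L(X)) (V : closed_subspace X)
    (P : bounded_op X V) : 'L(V) :=
  bop_comp P (bop_comp A (cs_incl V)).

(* The adjoined 0 only matters when V = {0}. *)
Definition discrete_norm (V : closed_subspace X) (S : V -> X) : \bar R :=
  ereal_sup (0%E |` [set (rnorm (S u) / rnorm u)%:E
                    | u in [set u : V | u != 0]]).

Definition T_compatible (T : 'L(X)) (Xn : nat -> closed_subspace X)
    (An : forall n, 'L(Xn n)) : Prop :=
  (forall n, fredholm_of_index (An n) 0) /\
  exists Tn : forall n, 'L(Xn n),
    (forall n, fredholm_of_index (Tn n) 0) /\
    discrete_norm (fun u : Xn n => T (\val u) - \val (Tn n u))
      @[n --> \oo] --> 0%E.

Definition compact_seq (u : nat -> X) : Prop :=
  forall phi : nat -> nat, {homo phi : m n / (m < n)%N} ->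
  exists psi : nat -> nat, {homo psi : m n / (m < n)%N} /\
    cvg (u (phi (psi k)) @[k --> \oo]).

Definition regular (Xn : nat -> closed_subspace X)
    (An : forall n, 'L(Xn n)) : Prop :=
  forall u : (forall n, Xn n),
    bounded_set (range (fun n => \val (u n))) ->
    compact_seq (fun n => \val (An n (u n))) ->
    compact_seq (fun n => \val (u n)).

End Operators.

(* Main.v *)
(** Let [B = T'A + C] be coercive with [C] compact and [T'] adjoint to [T], and
    pass to a subsequence along which [A_n u_n -> f] and [C u_n -> k]. For [v] in
    [X_n], replacing [T v] by [T_n v] costs [o(1)|v|], and
    [<A u_n, T_n v> = <A_n u_n, T_n v>]; hence [<B u_n, v>] differs from
    [<T'f + k, v>] by [o(1)|v|]. By Lax-Milgram [T'f + k = B u0] for some [u0];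
    testing with [v = u_n - P_n u0] and using coercivity gives [v -> 0], so
    [u_n -> u0]. *)
Require Import Defs.
From mathcomp Require Import all_boot all_order all_algebra.
From mathcomp Require Import sesquilinear complex ring lra.
From mathcomp Require Import all_classical all_reals all_analysis.
Import Order.TTheory GRing.Theory Num.Theory.
Import numFieldNormedType.Exports.
Local Open Scope classical_set_scope.
Local Open Scope ring_scope.
Local Open Scope complex_scope.

Set Implicit Arguments.
Unset Strict Implicit.

(** * Transfer between complex-valued and real-valued norms *)

Lemma real_complex_eq0 (R : rcfType) (x : R) : (x%:C == 0) = (x == 0).
Proof. exact: (inj_eq (@complexI R) x 0). Qed.

Section RealNorm.
Variable R : realType.
Implicit Types (V : normedZmodType R[i]).

Lemma rnormE V (u : V) : `|u| = (rnorm u)%:C.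
Proof. by rewrite /rnorm RRe_real ?normr_real. Qed.

Lemma rnorm_ge0 V (u : V) : 0 <= rnorm u.
Proof. by rewrite -ler0c -rnormE. Qed.

Lemma rnorm0 V : rnorm (0 : V) = 0.
Proof. by rewrite /rnorm normr0. Qed.

Lemma rnormN V (u : V) : rnorm (- u) = rnorm u.
Proof. by rewrite /rnorm normrN. Qed.

Lemma rnorm_gt0 V (u : V) : (0 < rnorm u) = (u != 0).
Proof. by rewrite -ltcR -rnormE normr_gt0. Qed.

Lemma rnormD V (u v : V) : rnorm (u + v) <= rnorm u + rnorm v.
Proof. by rewrite -lecR rmorphD /= -!rnormE ler_normD. Qed.

Lemma rnorm_mulrn V (u : V) n : rnorm (u *+ n) = rnorm u *+ n.
Proof. by apply: complexI; rewrite rmorphMn /= -!rnormE normrMn. Qed.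

(** Radii in a complex normed module are positive elements of [R[i]], hence real, so they correspond
    exactly to the positive radii in [R]. *)
Lemma cvg_rnormP (V : normedModType R[i]) (u : nat -> V) (l : V) :
  u n @[n --> \oo] --> l <-> rnorm (u n - l) @[n --> \oo] --> (0 : R).
Proof.
split=> [/cvgrPdist_lt cv|/cvgr0Pnorm_lt cv].
  apply/cvgr0Pnorm_lt => e e0; have := cv e%:C; rewrite ltcR => /(_ e0).
  apply: filterS => n; rewrite rnormE ltcR -rnormN opprB ger0_norm//.
  exact: rnorm_ge0.
apply/cvgrPdist_lt => e e0.
have er : (complex.Re e)%:C = e by rewrite RRe_real ?gtr0_real.
have := cv (complex.Re e); rewrite -ltcR er => /(_ e0).
apply: filterS => n; rewrite ger0_norm ?rnorm_ge0// -ltcR er -rnormE.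
by rewrite -normrN opprB.
Qed.

Lemma cvg_rnorm (V : normedModType R[i]) (u : nat -> V) (l : V) :
  u n @[n --> \oo] --> l -> rnorm (u n) @[n --> \oo] --> rnorm l.
Proof.
move=> /cvg_rnormP ul; apply/cvgrPdist_le => e e0.
have /cvgr0Pnorm_le/(_ e e0) := ul; apply: filterS => n.
rewrite ger0_norm ?rnorm_ge0// => le_e.
have := rnormD (u n - l) l; have := rnormD (l - u n) (u n).
rewrite !subrK -[l - u n]opprB rnormN ler_norml.
move: le_e; set a := rnorm _; set b := rnorm _; set c := rnorm _ => *.
by apply/andP; split; lra.
Qed.

Lemma bop_rnorm_bound (E F : normedModType R[i]) (B : bounded_op E F) :
  exists2 M : R, 0 <= M & forall u, rnorm (B u) <= M * rnorm u.
Proof.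
(* [M] may be any complex number, but [M * |u|] dominates a norm; it is therefore nonnegative and
   equals [|M| * |u|]. *)
have [M hM] := bop_bounded B; exists (rnorm M); first exact: rnorm_ge0.
move=> u; rewrite -lecR rmorphM /= -!rnormE.
have h0 : 0 <= M * `|u| by exact: le_trans (hM u).
by move: (hM u); rewrite -(ger0_norm h0) normrM normr_id.
Qed.

Lemma bounded_set_rnorm (V : normedModType R[i]) (S : set V) :
  bounded_set S -> exists2 M : R, 0 <= M & forall u, S u -> rnorm u <= M.
Proof.
(* Boundedness provides a bound for every number strictly above the real [M]; [|M| + 1] is one that
   is also nonnegative. *)
case=> M [Mr hM]; exists (rnorm (`|M| + 1)); first exact: rnorm_ge0.
move=> u Su; rewrite -lecR -!rnormE.
rewrite [`|_ + 1|]ger0_norm ?addr_ge0//.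
by apply: hM Su; rewrite (le_lt_trans (real_ler_norm Mr))// ltrDl.
Qed.

End RealNorm.

(** * Extraction of convergent subsequences *)

Lemma cvg_subseq_infty (phi : nat -> nat) :
  {homo phi : m n / (m < n)%N} -> phi n @[n --> \oo] --> \oo.
Proof.
move=> hphi; apply/cvgnyPge => A; exists A => // n /= An.
have le_phi k : (k <= phi k)%N by elim: k => // k /leq_ltn_trans; apply; apply: hphi.
exact: leq_trans (le_phi n).
Qed.

(** The sequence clusters at some [l] in the compact closure of [S]; indices whose terms come ever
    closer to [l] are chosen recursively. *)
Lemma precompact_subseq (R : realType) (V : normedModType R[i]) (S : set V)
    (x : nat -> V) : precompact S -> (forall n, S (x n)) ->
  exists psi : nat -> nat, {homo psi : m n / (m < n)%N} /\
    cvg (x (psi k) @[k --> \oo]).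
Proof.
rewrite precompactE => cS Sx.
have [|l [_ cl]] := cS (x n @[n --> \oo]) _.
  by exists 0%N => // n _; apply: subset_closure.
have near_l N (k : nat) : exists n, (N < n)%N /\ rnorm (x n - l) < k.+1%:R^-1.
  have e0 : 0 < (k.+1%:R^-1 : R)%:C by rewrite ltcR invr_gt0.
  have [|y [[n /= Nn xny]]] := cl [set y | exists2 n, (N < n)%N & x n = y]
      _ _ (nbhsx_ballx l _ e0).
    by exists N.+1 => // n /= Nn; exists n.
  rewrite -xny -ball_normE /= => xl; exists n; split => //.
  by rewrite -ltcR -rnormE -normrN opprB.
(* A state is an index of [x] paired with a step counter, which sets the required distance to
   [l]. *)
pose r (p q : nat * nat) := q.2 = p.2.+1 /\
  (p.1 < q.1)%N /\ rnorm (x q.1 - l) < q.2%:R^-1.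
have rP p : {q | r p q}.
  by apply: cid; have [n [Nn xn]] := near_l p.1 p.2; exists (n, p.2.+1).
have [f [f0 fS]] := dependent_choice rP (0, 0)%N.
have f2 k : (f k).2 = k.
  by elim: k => [|k IH]; rewrite ?f0//; case: (fS k) => -> _; rewrite IH.
(* The shift drops the initial state [(0, 0)], about which no closeness to [l] is known. *)
exists (fun k => (f k.+1).1); split.
  by apply: homo_ltn => [|k]; [exact: ltn_trans | have [_ []] := fS k.+1].
apply/cvg_ex; exists l; apply/cvg_rnormP.
apply: (squeeze_cvgr _ (cvg_cst 0) (@cvg_harmonic R)).
by near=> k; rewrite rnorm_ge0 ltW//; have [_ []] := fS k; rewrite f2.
Unshelve. all: by end_near. Qed.

(** * Geometry of the inner product *)

Section HilbertSpace.
Variables (R : realType) (X : hilbertType R).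
Implicit Types u v w : X.

Lemma inner_conj u v : inner u v = Num.conj (inner v u) :> R[i].
Proof. by rewrite (hermC (@inner R X) u v) mul1r. Qed.

Lemma innerDl u v w : inner (u + v) w = inner u w + inner v w :> R[i].
Proof. exact: linearDl. Qed.

Lemma innerDr u v w : inner u (v + w) = inner u v + inner u w :> R[i].
Proof. exact: (linearDr (@inner R X)). Qed.

Lemma innerBl u v w : inner (u - v) w = inner u w - inner v w :> R[i].
Proof. exact: linearBl. Qed.

Lemma innerBr u v w : inner u (v - w) = inner u v - inner u w :> R[i].
Proof. exact: (linearBr (@inner R X)). Qed.

Lemma innerZl (a : R[i]) u v : inner (a *: u) v = a * inner u v.
Proof. exact: linearZl_LR. Qed.

Lemma innerZr (a : R[i]) u v : inner u (a *: v) = Num.conj a * inner u v.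
Proof. exact: (linearZr_LR (@inner R X) u a v). Qed.

Lemma inner_rnorm u : inner u u = (rnorm u ^+ 2)%:C :> R[i].
Proof. by rewrite innerE rnormE rmorphXn. Qed.

(** Pythagoras for the component of [u] orthogonal to [w], multiplied by [|w|^2] to clear the
    denominator. It yields both Cauchy-Schwarz and the orthogonality of minimal residuals. *)
Lemma rnorm_sqr_orthogonal u w : w != 0 ->
  rnorm (u - (inner u w / inner w w) *: w) ^+ 2 * rnorm w ^+ 2 =
  rnorm u ^+ 2 * rnorm w ^+ 2 - rnorm (inner u w) ^+ 2.
Proof.
move=> w0; apply: complexI.
have wwE : Num.conj (inner w w : R[i]) = inner w w by rewrite -inner_conj.
have ww0 : inner w w != 0 :> R[i].
  by rewrite inner_rnorm real_complex_eq0 sqrf_eq0 gt_eqF// rnorm_gt0.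
rewrite rmorphB /=.
rewrite (rmorphM _ (_ ^+ 2) (_ ^+ 2)) (rmorphM _ (_ ^+ 2) (_ ^+ 2)) /= -!inner_rnorm.
rewrite rmorphXn /= -[(rnorm (inner u w))%:C]rnormE normCK.
rewrite innerBl !innerBr !innerZl !innerZr.
rewrite -(inner_conj w u).
have -> : Num.conj (inner u w / inner w w) = inner w u / inner w w.
  by rewrite rmorphM fmorphV /= wwE -inner_conj.
by field.
Qed.

Lemma Cauchy_Schwarz u v : rnorm (inner u v : R[i]) <= rnorm u * rnorm v.
Proof.
have [->|v0] := eqVneq v 0; first by rewrite linear0r !rnorm0 mulr0.
rewrite -(ler_pXn2r (n := 2)) ?nnegrE ?mulr_ge0 ?rnorm_ge0//.
by rewrite exprMn -subr_ge0 -rnorm_sqr_orthogonal// mulr_ge0 ?sqr_ge0.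
Qed.

Lemma parallelogram u v :
  rnorm (u + v) ^+ 2 + rnorm (u - v) ^+ 2 = 2 * (rnorm u ^+ 2 + rnorm v ^+ 2).
Proof.
apply: complexI; rewrite rmorphM !(rmorphD _ (_ ^+ 2)) /= -!inner_rnorm.
by rewrite innerBl !innerBr innerDl !innerDr rmorph_nat; ring.
Qed.

(** At [t = <u,w>/<w,w>] the Pythagorean identity shows a drop of [|<u,w>|^2] in [|u|^2 |w|^2],
    which minimality forbids unless it vanishes. *)
Lemma orthogonal_of_minimal u w :
  (forall t : R[i], rnorm u <= rnorm (u - t *: w)) -> inner u w = 0 :> R[i].
Proof.
have [->|w0 hmin] := eqVneq w 0; first by rewrite linear0r.
have := rnorm_sqr_orthogonal u w0; set v := u - _ => E.
have le_uv : rnorm u ^+ 2 <= rnorm v ^+ 2.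
  by rewrite ler_pXn2r ?nnegrE ?rnorm_ge0//; exact: hmin.
have w2 : 0 <= rnorm w ^+ 2 by exact: sqr_ge0.
have := ler_wpM2r w2 le_uv; rewrite E lerBrDr gerDl => le0.
have /eqP : rnorm (inner u w : R[i]) ^+ 2 = 0.
  by apply/eqP; rewrite eq_le le0 sqr_ge0.
by rewrite sqrf_eq0 => /eqP h; apply/eqP; rewrite -normr_eq0 rnormE h.
Qed.

(** * Coercive operators and their surjectivity *)

Lemma coerciveP (B : 'L(X)) : coercive B ->
  exists2 c : R, 0 < c &
    forall u, c * rnorm u ^+ 2 <= rnorm (inner (B u) u : R[i]).
Proof.
rewrite /coercive; set m := ereal_inf _ => m0.
(* If [X] is zero, the infimum is over the empty set and equals +oo; the constant 1 then serves. *)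
have [c c0 cm] : exists2 c : R, 0 < c & (c%:E <= m)%E.
  case: m m0 => [r| |] // r0; first by exists r.
  by exists 1; rewrite ?leey.
exists c => // u; have [->|u0] := eqVneq u 0.
  by rewrite rnorm0 expr0n mulr0 rnorm_ge0.
rewrite -ler_pdivlMr ?exprn_gt0 ?rnorm_gt0// -lee_fin (le_trans cm)//.
by apply: ereal_inf_lbound; exists u.
Qed.

Lemma cauchy_rnorm_cvg (x : nat -> X) :
  (forall e : R, 0 < e -> \forall m & n \near \oo, rnorm (x m - x n) < e) ->
  cvg (x n @[n --> \oo]).
Proof.
move=> hx; apply/cauchy_cvgP/cauchy_ballP => e e0.
have er : (complex.Re e)%:C = e by rewrite RRe_real ?gtr0_real.
have e0' : 0 < complex.Re e by rewrite -ltcR er.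
have := hx _ e0'.
rewrite !near_simpl /=; apply: filterS => -[m n] /=.
by rewrite -ball_normE /= -ltcR er -rnormE.
Qed.

Lemma bop_rnorm_cvg (B : 'L(X)) (x : nat -> X) (l : X) :
  x n @[n --> \oo] --> l -> B (x n) @[n --> \oo] --> B l.
Proof.
move=> /cvg_rnormP xl; have [M M0 hM] := bop_rnorm_bound B; apply/cvg_rnormP.
have xl' : M * rnorm (x n - l) @[n --> \oo] --> 0.
  by rewrite -(mulr0 M); apply: cvgMr.
apply: (squeeze_cvgr _ (cvg_cst 0) xl').
by near=> n; rewrite rnorm_ge0 -linearB hM.
Unshelve. all: by end_near. Qed.

(* A minimizer of [|B u - g|] exists since minimizing sequences are Cauchy, by
   the parallelogram law and the lower bound on [B]; its residual is orthogonal
   to the range of [B], hence zero by coercivity. *)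
Lemma Lax_Milgram (B : 'L(X)) (g : X) : coercive B -> exists u, B u = g.
Proof.
move=> /coerciveP[c c0 hB].
have lowB u : c * rnorm u <= rnorm (B u).
  have [->|u0] := eqVneq u 0; first by rewrite rnorm0 mulr0 rnorm_ge0.
  have u1 : 0 < rnorm u by rewrite rnorm_gt0.
  rewrite -(ler_pM2r u1) -mulrA -expr2.
  exact: le_trans (hB u) (Cauchy_Schwarz _ _).
pose res u := rnorm (B u - g) ^+ 2.
have res_inf : has_inf (range res).
  split; first by exists (res 0), 0.
  by exists 0 => _ [u _ <-]; exact: sqr_ge0.
pose d := inf (range res).
have d_res u : d <= res u by apply: ge_inf; [exact: res_inf.2 | exists u].
have minseq (n : nat) : exists u, res u < d + n.+1%:R^-1.
  have n0 : 0 < n.+1%:R^-1 :> R by rewrite invr_gt0.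
  by have [_ [u _ <-] ?] := inf_adherent n0 res_inf; exists u.
have {minseq}[x xP] := choice minseq.
have x_close m n : (c * rnorm (x m - x n)) ^+ 2 <=
    2 * m.+1%:R^-1 + 2 * n.+1%:R^-1.
  (* The residuals at [x m] and [x n] add up to twice the residual at the midpoint [w]. As
     [res w >= d], the parallelogram law leaves at most [2 (res (x m) + res (x n)) - 4 d] for
     [|B (x m - x n)|^2]. *)
  pose w := 2^-1 *: (x m + x n).
  have addE : (B (x m) - g) + (B (x n) - g) = (B w - g) *+ 2.
    rewrite linearZ/= linearD -scaler_nat scalerBr scalerA divff ?pnatr_eq0//.
    by rewrite scale1r scaler_nat addrACA -opprD mulr2n.
  have := parallelogram (B (x m) - g) (B (x n) - g).
  rewrite addE opprB addrA subrK -linearB rnorm_mulrn.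
  have := d_res w; have := xP m; have := xP n; rewrite /res.
  have : (c * rnorm (x m - x n)) ^+ 2 <= rnorm (B (x m - x n)) ^+ 2.
    by rewrite ler_pXn2r ?nnegrE ?rnorm_ge0 ?mulr_ge0 ?rnorm_ge0// ltW.
  rewrite -[rnorm (B w - g) *+ 2]mulr_natl exprMn.
  set a1 := _ ^+ 2; set a2 := _ ^+ 2; set a3 := rnorm _ ^+ 2.
  set a4 := rnorm _ ^+ 2; set a5 := rnorm _ ^+ 2.
  set e1 := _^-1; set e2 := _^-1; rewrite expr2; lra.
have [l xl] : exists l : X, x n @[n --> \oo] --> l.
  apply/cvg_ex; apply: cauchy_rnorm_cvg => e e0.
  (* Each of the two terms [2 / (m + 1)] and [2 / (n + 1)] then stays below half of [(c * e)^2]. *)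
  have e1 : 0 < (c * e) ^+ 2 / 4 by rewrite divr_gt0 ?exprn_gt0 ?mulr_gt0.
  have /cvgr0Pnorm_lt/(_ _ e1) := @cvg_harmonic R.
  move=> harm; near=> m n.
  have hm : m.+1%:R^-1 < (c * e) ^+ 2 / 4.
    rewrite -[ltLHS]ger0_norm ?invr_ge0//; near: m; exact: harm.
  have hn : n.+1%:R^-1 < (c * e) ^+ 2 / 4.
    rewrite -[ltLHS]ger0_norm ?invr_ge0//; near: n; exact: harm.
  rewrite -(ltr_pM2l c0) -(ltr_pXn2r (n := 2)) ?nnegrE ?mulr_ge0 ?rnorm_ge0 ?ltW//.
  apply: le_lt_trans (x_close m n) _; 
  move: hm hn; set a := m.+1%:R^-1; set b := n.+1%:R^-1; set s := _ ^+ 2.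
  lra.
have res_l : res l <= d.
  have c1 : res (x n) @[n --> \oo] --> res l.
    have : B (x n) - g @[n --> \oo] --> B l - g.
      by apply: cvgB; [exact: bop_rnorm_cvg | exact: cvg_cst].
    by move=> /cvg_rnorm h; rewrite /res expr2;
      under eq_fun do rewrite expr2; apply: cvgM.
  have c2 : d + n.+1%:R^-1 @[n --> \oo] --> d.
    by rewrite -[X in _ --> X]addr0; apply: cvgD; [exact: cvg_cst|exact: cvg_harmonic].
  by apply: (ler_cvg_to c1 c2); near=> n; apply/ltW.
exists l; apply/eqP; rewrite -subr_eq0; set w := B l - g.
(* [w - t B w] is the residual at [l - t w], so minimality of [l] makes [w] orthogonal to [B w]. *)
have : inner w (B w) = 0 :> R[i].
  apply: orthogonal_of_minimal => t.
  rewrite -(ler_pXn2r (n := 2)) ?nnegrE ?rnorm_ge0//.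
  apply: (le_trans res_l); rewrite /w addrAC -linearZ -linearB; exact: d_res.
move=> w0; have := hB w; rewrite inner_conj w0 rmorph0 rnorm0.
by rewrite pmulr_rle0// exprn_even_le0//= => /eqP h; rewrite -normr_eq0 rnormE h.
Unshelve. all: by end_near. Qed.

(** * Projection, discrete norm and the Galerkin error *)

(** The residual [w] is orthogonal to [P u], so [|w|^2 = <w,u> <= |w| |u|]. *)
Lemma orthogonal_residual_le (V : closed_subspace X) (P : bounded_op X V) u :
  orthogonal_projection P -> rnorm (u - \val (P u)) <= rnorm u.
Proof.
move=> hP; set w := u - _; have [->|w0] := eqVneq w 0.
  by rewrite rnorm0 rnorm_ge0.
have w1 : 0 < rnorm w by rewrite rnorm_gt0.
have wu : inner w u = inner w w :> R[i].
  by rewrite {3}/w innerBr hP subr0.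
rewrite -(ler_pM2l w1) -expr2; have := Cauchy_Schwarz w u.
by rewrite wu inner_rnorm {1}/rnorm ger0_norm// ler0c sqr_ge0.
Qed.

Lemma discrete_norm_ge0 (V : closed_subspace X) (S : V -> X) :
  (0 <= discrete_norm S)%E.
Proof. by apply: ereal_sup_ubound; left. Qed.

(** The supremum leaves out the zero vector, which [S 0 = 0] covers; finiteness excludes that [fine]
    turns +oo into 0. *)
Lemma discrete_norm_ub (V : closed_subspace X) (S : V -> X) (v : V) :
  S 0 = 0 -> discrete_norm S \is a fin_num ->
  rnorm (S v) <= fine (discrete_norm S) * rnorm (\val v).
Proof.
move=> S0 Sfin; have [->|v0] := eqVneq v 0.
  by rewrite S0 !rnorm0 mulr_ge0 ?rnorm_ge0// fine_ge0// discrete_norm_ge0.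
have v1 : 0 < rnorm v by rewrite rnorm_gt0.
rewrite -[rnorm (\val v)]/(rnorm v) -ler_pdivrMr// -lee_fin fineK//.
by apply: ereal_sup_ubound; right; exists v.
Qed.

(* With [v] the discrete error, [inner (B v) v] splits into four terms. Since the
   residual of [P] is orthogonal to [Tn v], [A un - P (A un)] is only tested
   against [T v - Tn v]. *)
Lemma galerkin_error_bound (V : closed_subspace X) (P : bounded_op X V)
    (T T' A C : 'L(X)) (Tn : 'L(V)) (c d MT MB : R) (u0 f k : X) (un : V) :
  orthogonal_projection P -> is_adjoint T T' -> 0 <= d ->
  let B := bop_add (bop_comp T' A) C in
  (forall u, c * rnorm u ^+ 2 <= rnorm (inner (B u) u : R[i])) ->
  (forall v : V, rnorm (T (\val v) - \val (Tn v)) <= d * rnorm (\val v)) ->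
  (forall u, rnorm (T u) <= MT * rnorm u) ->
  (forall u, rnorm (B u) <= MB * rnorm u) ->
  B u0 = T' f + k ->
  c * rnorm (\val un - \val (P u0)) <=
    rnorm (A (\val un)) * d + MT * rnorm (\val (galerkin A P un) - f)
    + rnorm (C (\val un) - k) + MB * rnorm (u0 - \val (P u0)).
Proof.
move=> hP hT d0 B hB hTn hMT hMB Bu0.
pose v : V := un - P u0; have vE : \val v = \val un - \val (P u0) by rewrite raddfB.
rewrite -vE; have [v0|v0] := eqVneq (\val v) 0.
  (* No sign of [MT] or [MB] is assumed; their products with norms are nonnegative because they
     dominate norms. *)
  by rewrite v0 rnorm0 mulr0 !addr_ge0 ?(mulr_ge0 (rnorm_ge0 _) d0) ?rnorm_ge0//;
    [exact: le_trans (rnorm_ge0 _) (hMT _)|exact: le_trans (rnorm_ge0 _) (hMB _)].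
have v1 : 0 < rnorm (\val v) by rewrite rnorm_gt0.
have adj x y : inner (T' x) y = inner x (T y) :> R[i].
  by rewrite inner_conj -hT -inner_conj.
pose r := A (\val un) - \val (P (A (\val un))).
have split_inner : inner (B (\val v)) (\val v) =
    inner r (T (\val v) - \val (Tn v))
    + inner (\val (galerkin A P un) - f) (T (\val v))
    + inner (C (\val un) - k) (\val v)
    + inner (B (u0 - \val (P u0))) (\val v) :> R[i].
  have rT : inner r (\val (Tn v)) = 0 :> R[i] by exact: hP.
  have -> : B (\val v) = T' (A (\val un)) + C (\val un) - B (\val (P u0)).
    by rewrite vE linearB.
  rewrite (linearB B) Bu0 (innerBr r) rT subr0 /r /=.
  by rewrite !(innerBl, innerDl) !adj; ring.
have := hB (\val v); rewrite split_inner => le_sum.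
rewrite -(ler_pM2r v1) -mulrA -expr2; apply: (le_trans le_sum).
apply: (le_trans (rnormD _ _)); rewrite mulrDl lerD//; last first.
  apply: le_trans (Cauchy_Schwarz _ _) _.
  by rewrite ler_wpM2r ?rnorm_ge0.
apply: (le_trans (rnormD _ _)); rewrite mulrDl lerD//; last exact: Cauchy_Schwarz.
apply: (le_trans (rnormD _ _)); rewrite mulrDl lerD//; last first.
  apply: le_trans (Cauchy_Schwarz _ _) _.
  by rewrite [MT * _]mulrC -mulrA ler_wpM2l ?rnorm_ge0.
apply: le_trans (Cauchy_Schwarz _ _) _; rewrite -mulrA.
by apply: ler_pM; rewrite ?rnorm_ge0// orthogonal_residual_le.
Qed.

End HilbertSpace.

(** * Regularity of the Galerkin approximations *)

Theorem theorem1p8 (R : realType) (X : hilbertType R)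
    (Xn : nat -> closed_subspace X) (P : forall n, bounded_op X (Xn n))
    (P_proj : forall n, orthogonal_projection (P n))
    (P_cvg : forall u : X, rnorm (u - \val (P n u)) @[n --> \oo] --> (0 : R))
    (T A : 'L(X)) (T_bij : bijective T) (A_coercive : weakly_T_coercive T A)
    (A_compat : T_compatible T (fun n => galerkin A (P n))) :
  regular (fun n => galerkin A (P n)).
Proof.
have [T' [adjT [C [C_compact B_coercive]]]] := A_coercive.
have [_ [Tn [_ Tn_cvg]]] := A_compat.
set B := bop_add (bop_comp T' A) C in B_coercive.
have [c c0 hB] := coerciveP B_coercive.
have [MT MT0 hMT] := bop_rnorm_bound T.
have [MB MB0 hMB] := bop_rnorm_bound B.
have [MA MA0 hMA] := bop_rnorm_bound A.
pose d n := discrete_norm (fun v : Xn n => T (\val v) - \val (Tn n v)).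
have d_ge0 n : 0 <= fine (d n) by rewrite fine_ge0 ?discrete_norm_ge0.
(* Convergence to 0 in the extended reals splits into eventual finiteness and convergence of the
   real parts. *)
move: Tn_cvg => /fine_cvgP[d_fin d_cvg].
move=> u u_bd Au_compact phi hphi.
have [M M0 uM] := bounded_set_rnorm u_bd.
have [psi1 [hpsi1 /cvg_ex[/= f /cvg_rnormP f_cvg]]] := Au_compact phi hphi.
have [|psi2 [hpsi2 /cvg_ex[/= k /cvg_rnormP k_cvg]]] :=
    precompact_subseq (x := fun i => C (\val (u (phi (psi1 i))))) (C_compact _ u_bd).
  by move=> n; exists (\val (u (phi (psi1 n)))) => //; exists (phi (psi1 n)).
have [u0 Bu0] := Lax_Milgram (T' f + k) B_coercive.
exists (psi1 \o psi2); split; first by move=> m n mn; apply/hpsi1/hpsi2.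
apply/cvg_ex; exists u0; apply/cvg_rnormP => /=.
pose j i := phi (psi1 (psi2 i)).
have j_oo : j i @[i --> \oo] --> \oo.
  by apply: cvg_subseq_infty => m n mn; apply/hphi/hpsi1/hpsi2.
have psi2_oo := cvg_subseq_infty hpsi2.
have d_sub : fine (d (j i)) @[i --> \oo] --> 0 by exact: cvg_comp j_oo d_cvg.
have P_sub : rnorm (u0 - \val (P (j i) u0)) @[i --> \oo] --> 0.
  exact: cvg_comp j_oo (P_cvg u0).
have f_sub : rnorm (\val (galerkin A (P (j i)) (u (j i))) - f) @[i --> \oo] --> 0.
  exact: cvg_comp psi2_oo f_cvg.
(* The Galerkin error bound with [|A u_n| <= MA * M], divided by the coercivity constant, plus the
   distance from [u0] to its projection, which the triangle inequality adds. *)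
pose err i := c^-1 * (MA * M * fine (d (j i))
  + MT * rnorm (\val (galerkin A (P (j i)) (u (j i))) - f)
  + rnorm (C (\val (u (j i))) - k) + MB * rnorm (u0 - \val (P (j i) u0)))
  + rnorm (u0 - \val (P (j i) u0)).
have err_cvg : err i @[i --> \oo] --> 0.
  rewrite (_ : 0 = c^-1 * (MA * M * 0 + MT * 0 + 0 + MB * 0) + 0 :> R); last first.
    by rewrite !mulr0 !addr0 mulr0.
  by do ![exact: f_sub|exact: d_sub|exact: P_sub|exact: k_cvg|apply: cvgD|apply: cvgMr].
apply: (squeeze_cvgr _ (cvg_cst 0) err_cvg).
(* Since [fine] sends +oo to 0, the estimate through [fine (d (j i))] is claimed only for late
   indices, where [d (j i)] is finite. *)
have d_fin_sub : \forall i \near \oo, d (j i) \is a fin_num by exact: j_oo d_fin.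
near=> i; rewrite rnorm_ge0 /=.
have djP (v : Xn (j i)) :
    rnorm (T (\val v) - \val (Tn (j i) v)) <= fine (d (j i)) * rnorm (\val v).
  apply: discrete_norm_ub; last by near: i.
  have val0 : \val (0 : Xn (j i)) = 0 by exact: raddf0.
  by rewrite (linear0 (Tn (j i))) val0 (linear0 T) subrr.
have := galerkin_error_bound (u (j i)) (P_proj (j i)) adjT (d_ge0 _) hB djP hMT hMB Bu0.
move=> est; have Au_le : rnorm (A (\val (u (j i)))) <= MA * M.
  by apply: le_trans (hMA _) _; rewrite ler_wpM2l// uM//; exists (j i).
have := rnormD (\val (u (j i)) - \val (P (j i) u0)) (\val (P (j i) u0) - u0).
rewrite addrA subrK => /le_trans; apply.
rewrite -[_ - u0]opprB rnormN lerD2r ler_pdivlMl//; apply: le_trans est _.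
by rewrite !lerD2r ler_wpM2r.
Unshelve. all: by end_near. Qed.
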